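(* Let $p$ be a prime and let $f\colon \mathbb{Z}_p\to\mathbb{Z}_p$ be a compatible function with coordinate representation $$f(x_0+px_1+\ldots+p^kx_k+\ldots)=\varphi_0(x_0)+p\varphi_1(x_0,x_1)+\ldots+p^k\varphi_k(x_0,x_1,\ldots,x_k)+\ldots ,$$ where $\varphi_0$ and all the maps $\varphi_{k,\bar{x}_{k-1}}$, $k=1,2,\ldots$, are permutations of the set of residues modulo $p$. Then $f$ is ergodic if and only if both of the following hold: (1) $\varphi_0$ is transitive on the set of residues modulo $p$; (2) for every $k=1,2,\ldots$ and every $\bar{x}_{k-1}=(x_0,\ldots,x_{k-1})\in\{0,\ldots,p-1\}^k$, the permutation $$F_{k,\bar{x}_{k-1}}=\varphi_{k,f_{k-1}^{(p^k-1)}(\bar{x}_{k-1})}\circ\varphi_{k,f_{k-1}^{(p^k-2)}(\bar{x}_{k-1})}\circ\ldots\circ\varphi_{k,f_{k-1}(\bar{x}_{k-1})}\circ\varphi_{k,\bar{x}_{k-1}}$$ is transitive on the set of residues modulo $p$.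
   Context: $\mathbb{Z}_p$ is the ring of $p$-adic integers with valuation $|\cdot|_p$ and Haar measure $\mu_p$ normalized by $\mu_p(\mathbb{Z}_p)=1$; ergodicity is with respect to $\mu_p$ (an ergodic map is measure preserving and every invariant measurable set has measure $0$ or $1$). A function $f\colon\mathbb{Z}_p\to\mathbb{Z}_p$ is compatible if $|f(x)-f(y)|_p\le|x-y|_p$ for all $x,y$. Every $x\in\mathbb{Z}_p$ has a canonical expansion $x=x_0+px_1+\ldots$ with $x_i\in\{0,\ldots,p-1\}$; for compatible $f$ the $k$-th base-$p$ digit of $f(x)$ depends only on $x_0,\ldots,x_k$ and is denoted $\varphi_k(x_0,\ldots,x_k)\in\{0,\ldots,p-1\}$ (coordinate representation). The set $\{0,\ldots,p-1\}$ is identified with $\mathbb{Z}/p\mathbb{Z}$. For $\bar{x}_{k-1}=(x_0,\ldots,x_{k-1})$, $\varphi_{k,\bar{x}_{k-1}}$ is the map $x_k\mapsto\varphi_k(x_0,\ldots,x_{k-1},x_k)$ of $\{0,\ldots,p-1\}$ to itself. A vector $\bar{x}_{k-1}$ is identified with the residue $x_0+px_1+\ldots+p^{k-1}x_{k-1}$ modulo $p^k$. $f_k$ denotes the induced map $x\bmod p^{k+1}\mapsto f(x)\bmod p^{k+1}$, in coordinates $(x_0,\ldots,x_k)\mapsto(\varphi_0(x_0),\varphi_1(x_0,x_1),\ldots,\varphi_k(x_0,\ldots,x_k))$, so $f_0=\varphi_0$; $f_{k-1}^{(s)}$ is its $s$-fold iterate for index $k-1$. Here $\circ$ is composition (rightmost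 factor applied first). A permutation of a finite set is transitive if it consists of a single cycle through all elements. *)

(* Defs.v *)
From HB Require Import structures.
From mathcomp Require Import all_boot all_order all_algebra.
From mathcomp Require Import all_classical all_reals all_analysis.

Set Implicit Arguments.
Unset Strict Implicit.
Unset Printing Implicit Defensive.

Import Order.TTheory GRing.Theory Num.Theory.

Local Open Scope classical_set_scope.
Local Open Scope ring_scope.

(* Z_p is the inverse limit of the rings Z/p^n, n >= 1: [residue x n] is
   x mod p^(n+1).  The indexing from p^1 avoids 'Z_1, which is Z/2Z in MathComp.
   Everything below is meant for p prime; the ring axioms hold for every
   natural number p because 'Z_0 = 'Z_1 = 'Z_2. *)
Record padic_int (p : nat) : Type := PadicInt {
  residue :> forall n : nat, 'Z_(p ^ n.+1);
  residue_coherent : forall n, residue n = inZp (residue n.+1)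
}.

Lemma padic_intP p (x y : padic_int p) :
  (forall n, residue x n = residue y n) -> x = y.
Proof.
case: x y => [x xP] [y yP] /= xy.
have {}xy : x = y by apply: functional_extensionality_dep.
by subst y; congr PadicInt; exact: Prop_irrelevance.
Qed.

Lemma modulus_dvd p n : ((Zp_trunc (p ^ n.+1)).+2 %| (Zp_trunc (p ^ n.+2)).+2)%N.
Proof.
case: p => [|[|p]]; first by rewrite !exp0n.
  by rewrite !exp1n.
have lt1 m : (1 < p.+2 ^ m.+1)%N by rewrite -[1%N](exp1n m.+1) ltn_exp2r.
by rewrite !Zp_cast ?lt1 // dvdn_exp2l.
Qed.

Section RingOperations.
Variable p : nat.
Implicit Types x y : padic_int p.

HB.instance Definition _ := gen_eqMixin (padic_int p).
HB.instance Definition _ := gen_choiceMixin (padic_int p).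

Fact padic_const_subproof (c : nat) n :
  (inZp c : 'Z_(p ^ n.+1)) = inZp (inZp c : 'Z_(p ^ n.+2)).
Proof. by apply: val_inj; rewrite /= modn_dvdm // modulus_dvd. Qed.

Fact padic_opp_subproof x n : - x n = inZp (- x n.+1 : 'Z_(p ^ n.+2)).
Proof.
rewrite (residue_coherent x n); apply: val_inj => /=.
have := modulus_dvd p n; set d := _.+2; set e := _.+2 => de.
rewrite modn_dvdm //; apply/eqP.
rewrite -(eqn_modDr (x n.+1)) subnK ?(ltnW (ltn_ord _)) //.
rewrite -modnDmr subnK ?(ltnW (ltn_pmod _ _)) //.
by rewrite modnn eq_sym.
Qed.

Fact padic_add_subproof x y n :
  x n + y n = inZp (x n.+1 + y n.+1 : 'Z_(p ^ n.+2))%R.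
Proof.
rewrite (residue_coherent x n) (residue_coherent y n); apply: val_inj => /=.
by rewrite modnDm modn_dvdm // modulus_dvd.
Qed.

Fact padic_mul_subproof x y n :
  x n * y n = inZp (x n.+1 * y n.+1 : 'Z_(p ^ n.+2))%R.
Proof.
rewrite (residue_coherent x n) (residue_coherent y n); apply: val_inj => /=.
by rewrite modnMm modn_dvdm // modulus_dvd.
Qed.

Definition padic_zero : padic_int p := PadicInt (padic_const_subproof 0).
Definition padic_one : padic_int p := PadicInt (padic_const_subproof 1).
Definition padic_opp x : padic_int p := PadicInt (padic_opp_subproof x).
Definition padic_add x y : padic_int p := PadicInt (padic_add_subproof x y).
Definition padic_mul x y : padic_int p := PadicInt (padic_mul_subproof x y).

Fact inZp0 n : inZp 0 = 0 :> 'Z_(p ^ n.+1).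
Proof. by apply: val_inj; rewrite /= mod0n. Qed.

Fact inZp1 n : inZp 1 = 1 :> 'Z_(p ^ n.+1).
Proof. exact: val_inj. Qed.

Fact padic_addA : associative padic_add.
Proof. by move=> x y z; apply: padic_intP => n /=; rewrite addrA. Qed.
Fact padic_addC : commutative padic_add.
Proof. by move=> x y; apply: padic_intP => n /=; rewrite addrC. Qed.
Fact padic_add0 : left_id padic_zero padic_add.
Proof. by move=> x; apply: padic_intP => n /=; rewrite inZp0 add0r. Qed.
Fact padic_addN : left_inverse padic_zero padic_opp padic_add.
Proof. by move=> x; apply: padic_intP => n /=; rewrite inZp0 addNr. Qed.

HB.instance Definition _ := GRing.isZmodule.Build (padic_int p)
  padic_addA padic_addC padic_add0 padic_addN.

Fact padic_mulA : associative padic_mul.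
Proof. by move=> x y z; apply: padic_intP => n /=; rewrite mulrA. Qed.
Fact padic_mulC : commutative padic_mul.
Proof. by move=> x y; apply: padic_intP => n /=; rewrite mulrC. Qed.
Fact padic_mul1 : left_id padic_one padic_mul.
Proof. by move=> x; apply: padic_intP => n /=; rewrite inZp1 mul1r. Qed.
Fact padic_mulDl : left_distributive padic_mul padic_add.
Proof. by move=> x y z; apply: padic_intP => n /=; rewrite mulrDl. Qed.
Fact padic_one_neq0 : padic_one != 0.
Proof.
apply/eqP => /(congr1 (fun x : padic_int p => residue x 0)) /=.
by rewrite inZp0 inZp1 => /eqP; rewrite oner_eq0.
Qed.

HB.instance Definition _ := GRing.Zmodule_isComNzRing.Build (padic_int p)
  padic_mulA padic_mulC padic_mul1 padic_mulDl padic_one_neq0.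

End RingOperations.

Section Valuation.
Variable p : nat.
Implicit Types x y : padic_int p.

(* The exponent of p in x (and 0 at x = 0): p^n divides x and p^(n+1) does not
   exactly when n is the least index with x != 0 mod p^(n+1). *)
Definition padic_val x : nat :=
  if pselect (exists n, x n != 0) is left x_neq0 then ex_minn x_neq0 else 0%N.

Definition padic_norm x : rat := if x == 0 then 0 else p%:R ^- padic_val x.

Definition padic_open (U : set (padic_int p)) : Prop :=
  forall x, U x ->
    exists2 r : rat, 0 < r & forall y, padic_norm (y - x) < r -> U y.

Fact padic_openT : padic_open setT.
Proof. by move=> x _; exists 1. Qed.

Fact padic_openI : setI_closed padic_open.
Proof.
move=> U V oU oV x [/oU[r r0 rU] /oV[s s0 sV]].
exists (Order.min r s); first by rewrite lt_min r0.
by move=> y; rewrite lt_min => /andP[/rU ? /sV ?].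
Qed.

Fact padic_open_bigU (I : Type) (F : I -> set (padic_int p)) :
  (forall i, padic_open (F i)) -> padic_open (\bigcup_i F i).
Proof.
by move=> oF x [i _ /oF[r r0 rF]]; exists r => // y /rF ?; exists i.
Qed.

HB.instance Definition _ := isOpenTopological.Build (padic_int p)
  padic_openT padic_openI padic_open_bigU.
HB.instance Definition _ := isPointed.Build (padic_int p) 0.

(* Borel sigma-algebra *)
HB.instance Definition _ := @isMeasurable.Build
  (sigma_display (@open (padic_int p))) (padic_int p)
  <<s @open (padic_int p) >>
  (@sigma_algebra0 _ setT _) (@sigma_algebraC _ _) (@sigma_algebra_bigcup _ setT _).

Definition compatible (f : padic_int p -> padic_int p) : Prop :=
  forall x y, padic_norm (f x - f y) <= padic_norm (x - y).

End Valuation.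

Section Ergodicity.
Variables (R : realType) (p : nat).

(* The normalisation mu Z_p = 1 is part of the type of mu.  Regularity is
   automatic for a finite Borel measure on the compact metric space Z_p. *)
Definition is_haar (mu : probability (padic_int p) R) : Prop :=
  forall (a : padic_int p) (A : set (padic_int p)), measurable A ->
    mu [set a + x | x in A] = mu A.

Definition measure_preserving (mu : probability (padic_int p) R)
    (f : padic_int p -> padic_int p) : Prop :=
  measurable_fun setT f /\ forall A, measurable A -> mu (f @^-1` A) = mu A.

Definition ergodic (mu : probability (padic_int p) R)
    (f : padic_int p -> padic_int p) : Prop :=
  measure_preserving mu f /\
  forall A, measurable A -> f @^-1` A = A -> mu A = 0%E \/ mu A = 1%E.

End Ergodicity.

(* For p >= 2, 'Z_p is the finite type {0, ..., p - 1}. *)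
Section Coordinates.
Variable p : nat.

(* k-th digit of the canonical expansion: ((x mod p^(k+1)) div p^k). *)
Definition digit (x : padic_int p) (k : nat) : 'Z_p := inZp (x k %/ p ^ k)%N.

Definition digits (x : padic_int p) (k : nat) : k.-tuple 'Z_p :=
  [tuple digit x i | i < k].

Definition coordinate_representation (f : padic_int p -> padic_int p)
    (phi : forall k, k.+1.-tuple 'Z_p -> 'Z_p) : Prop :=
  forall x k, digit (f x) k = phi k (digits x k.+1).

Variable phi : forall k, k.+1.-tuple 'Z_p -> 'Z_p.

(* phi_{k, xbar} for xbar = (x_0, ..., x_{k-1}); for k = 0 this is phi_0. *)
Definition coord_section (k : nat) (xbar : k.-tuple 'Z_p) : 'Z_p -> 'Z_p :=
  fun xk => phi [tuple of rcons xbar xk].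

(* The index counts coordinates: [induced k] is the map written f_{k-1}, acting
   on k-tuples (x_0, ..., x_{k-1}), i.e. on residues modulo p^k. *)
Definition induced (k : nat) (xbar : k.-tuple 'Z_p) : k.-tuple 'Z_p :=
  [tuple phi [tuple tnth xbar (widen_ord (ltn_ord i) j) | j < i.+1] | i < k].

(* phi_{k, f_{k-1}^(s-1)(xbar)} o ... o phi_{k, f_{k-1}(xbar)} o phi_{k, xbar},
   with s factors. *)
Fixpoint coord_comp (k : nat) (xbar : k.-tuple 'Z_p) (s : nat) : 'Z_p -> 'Z_p :=
  if s is s'.+1
  then coord_section (iter s' (@induced k) xbar) \o coord_comp xbar s'
  else id.

Definition coord_cycle (k : nat) (xbar : k.-tuple 'Z_p) : 'Z_p -> 'Z_p :=
  coord_comp xbar (p ^ k).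

End Coordinates.

(* A single cycle through all elements; this entails that g is a permutation. *)
Definition transitive_perm (T : eqType) (g : T -> T) : Prop :=
  exists c : seq T, ufcycle g c /\ forall x, x \in c.

(* Main.v *)
Require Import Defs.
From HB Require Import structures.
From mathcomp Require Import all_boot all_order all_algebra.
From mathcomp Require Import all_classical all_reals all_analysis.

(* Let g_k be the map induced by f on the first k digits; it is a permutation
   since all the coordinate maps are.  Haar measure gives all cylinders of the
   same level the same measure, and f pulls a level-k cylinder back to another
   one, so f preserves mu.

   f is ergodic iff every g_k is a single cycle.  The preimage of a g_k-orbit is
   f-invariant, and it is neither null nor of full measure if the orbit is
   proper.  Conversely, if A is invariant then mu (A & C) is constant along
   the g_k-orbit of the cylinder C, hence equal to mu A * mu C; by uniqueness
   of measures this extends to mu (A & B) = mu A * mu B for all Borel B, and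
   B = A yields mu A = (mu A)^2.

   Finally g_(k+1) is a skew product over g_k, and if g_k is a cycle of length
   p^k, then g_(k+1) is a cycle iff its return maps to the fibers, which are
   the permutations F of condition (2), are cycles. *)

Set Implicit Arguments.
Unset Strict Implicit.
Unset Printing Implicit Defensive.

Import Order.TTheory GRing.Theory Num.Theory.

(** * Permutations of a finite set with a single orbit *)

Section Transitivity.
Variables (T : finType) (g : T -> T).
Hypothesis g_inj : injective g.

(** Injectivity closes the orbit of a point up into a cycle, and connectedness makes this cycle
    exhaust [T]. *)
Lemma transitive_permP : (0 < #|T|)%N ->
  transitive_perm g <-> forall x y, fconnect g x y.
Proof.
move=> /card_gt0P[x0 _]; split=> [[c [/andP[gc _] cT]] x y | gT].
  by rewrite (fconnect_cycle gc).
exists (orbit g x0); split; last by move=> x; rewrite -fconnect_orbit.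
by apply/andP; rewrite cycle_orbit ?orbit_uniq.
Qed.

Lemma transitive_order x : (forall y, fconnect g x y) -> order g x = #|T|.
Proof. by move=> gx; apply: eq_card => y; rewrite !inE gx. Qed.

End Transitivity.

(** * Skew products over a single cycle *)

Section SkewProduct.
Variables (S T : finType) (g : S -> S) (h : S -> T -> T).
Hypotheses (g_inj : injective g) (h_inj : forall s, injective (h s)).

Let G (u : S * T) := (g u.1, h u.1 u.2).

(** The cocycle of the skew product [G], of which [coord_comp] is an instance; at [n = #|S|] it is
    the return map. *)
Fixpoint fiber_comp (s : S) (n : nat) : T -> T :=
  if n is m.+1 then h (iter m g s) \o fiber_comp s m else id.

Lemma fiber_comp_inj s n : injective (fiber_comp s n).
Proof. by elim: n => [|n IHn] //=; exact: inj_comp. Qed.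

Lemma iter_skew n s x : iter n G (s, x) = (iter n g s, fiber_comp s n x).
Proof. by elim: n => [|n IHn] //=; rewrite IHn. Qed.

Hypothesis g_tr : forall s t, fconnect g s t.

Lemma iter_skew_period n s x :
  iter (n * #|S|) G (s, x) = (s, iter n (fiber_comp s #|S|) x).
Proof.
elim: n => [|n IHn] //; rewrite mulSn iterD IHn iter_skew /=.
by rewrite -{1}(transitive_order (g_tr s)) iter_order.
Qed.

(* A G-orbit returns to the fiber over s exactly at the multiples of #|S|,
   where it moves along an orbit of the return map. *)
Lemma skew_transitive :
  (forall u v, fconnect G u v) <->
  (forall s x y, fconnect (fiber_comp s #|S|) x y).
Proof.
split=> [G_tr s x y | F_tr [s x] [t y]].
  have /iter_findex := G_tr (s, x) (s, y).
  set n := findex _ _ _ => E.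
  have: order g s %| n.
    have := E; rewrite iter_skew => -[gn _].
    have gq q r : iter (r + q * order g s) g s = iter r g s.
      rewrite iterD; congr iter; elim: q => // q IHq.
      by rewrite mulSn iterD IHq iter_order.
    move: gn; rewrite {1}(divn_eq n (order g s)) addnC gq => gr.
    (* The remainder is below the order, so it is the index in the orbit of the point it reaches;
       that point is [s], of index 0. *)
    have := @findex_iter _ g s (n %% order g s).
    by rewrite gr findex0 /dvdn => <- //; rewrite ltn_pmod ?order_gt0.
  rewrite (transitive_order (g_tr s)) => /dvdnP[m nE].
  by move: E; rewrite nE iter_skew_period => -[<-]; exact: fconnect_iter.
(* First reach the fiber over [t], then move inside it by whole turns around the base. *)
have /iter_findex := g_tr s t; set n := findex _ _ _ => E.
apply: (connect_trans (fconnect_iter _ n _)); rewrite iter_skew E.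
have /iter_findex <- := F_tr t (fiber_comp s n x) y.
by rewrite -iter_skew_period fconnect_iter.
Qed.

End SkewProduct.

(** * Residues and digits of p-adic integers *)

Section Digits.
Variable p : nat.
Hypothesis p_gt1 : (1 < p)%N.
Implicit Types x y : padic_int p.

Lemma exp_gt1 n : (1 < p ^ n.+1)%N.
Proof. by rewrite -[1%N](exp1n n.+1) ltn_exp2r. Qed.

Lemma card_digits k : #|{: k.-tuple 'Z_p}| = (p ^ k)%N.
Proof. by rewrite card_tuple card_ord (Zp_cast p_gt1). Qed.

Lemma residue_ltn x n : (x n < p ^ n.+1)%N.
Proof. by rewrite -[X in (_ < X)%N](Zp_cast (exp_gt1 n)) ltn_ord. Qed.

Lemma residue_mod x i n : (i <= n)%N -> x i = x n %% p ^ i.+1 :> nat.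
Proof.
elim: n => [|n IHn]; first by rewrite leqn0 => /eqP->; rewrite modn_small ?residue_ltn.
rewrite leq_eqVlt => /predU1P[->|/[!ltnS] le_in].
  by rewrite modn_small ?residue_ltn.
rewrite IHn // (residue_coherent x n) /= (Zp_cast (exp_gt1 n)).
by rewrite modn_dvdm // dvdn_exp2l.
Qed.

Lemma digitE x k : digit x k = x k %/ p ^ k :> nat.
Proof.
rewrite /digit /= (Zp_cast p_gt1) modn_small //.
by rewrite ltn_divLR ?expn_gt0 ?(ltnW p_gt1) // -expnS residue_ltn.
Qed.

Lemma residue_split x k : x k.+1 = digit x k.+1 * p ^ k.+1 + x k :> nat.
Proof. by rewrite digitE (residue_mod x (leqnSn k)) -divn_eq. Qed.

Lemma digits_rcons x k : digits x k.+1 = [tuple of rcons (digits x k) (digit x k)].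
Proof.
apply: eq_from_tnth => i.
rewrite tnth_mktuple (tnth_nth (digit x k)) /= nth_rcons size_map size_enum_ord.
have [lt_ik|] := ltnP i k.
  by rewrite -(@tnth_nth _ _ _ (digits x k) (Ordinal lt_ik)) tnth_mktuple.
move=> le_ki; have /eqP-> : i == k :> nat by rewrite eqn_leq le_ki -ltnS ltn_ord.
by rewrite eqxx.
Qed.

Lemma rcons_tuple_inj (T : Type) n (s t : n.-tuple T) (a b : T) :
  [tuple of rcons s a] = [tuple of rcons t b] -> s = t /\ a = b.
Proof. by move=> /(congr1 val) /rcons_inj[st ->]; split=> //; exact: val_inj. Qed.

(** A digit is read off the residue of the same index; conversely [residue_split] rebuilds each
    residue from its top digit and the previous residue. *)
Lemma digits_eqP x y k :
  digits x k = digits y k <-> forall i, (i < k)%N -> x i = y i.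
Proof.
split=> [|xy]; last first.
  by apply: eq_from_tnth => i; rewrite !tnth_mktuple /digit xy.
elim: k => // k IHk; rewrite !digits_rcons.
move=> /(@rcons_tuple_inj _ _ _ _ _ _)[/IHk xy dxy] i.
rewrite ltnS leq_eqVlt => /predU1P[->|]; last exact: xy.
apply: val_inj => /=; case: k {IHk} => [|k] in xy dxy *.
  have d0 (z : padic_int p) : z 0%N = digit z 0 :> nat by rewrite digitE expn0 divn1.
  by rewrite [LHS]d0 [RHS]d0 dxy.
by rewrite !residue_split dxy xy.
Qed.

Lemma tuple_rcons (T : Type) n (t : n.+1.-tuple T) :
  exists s : n.-tuple T, exists a, t = [tuple of rcons s a].
Proof.
case: t => t; case/lastP: t => // s a st.
have ss : size s == n by rewrite -eqSS -(size_rcons s a).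
by exists (Tuple ss), a; apply: val_inj.
Qed.

Definition padic_nat (n : nat) : padic_int p := PadicInt (padic_const_subproof p n).

Lemma digits_surj k (t : k.-tuple 'Z_p) : exists x, digits x k = t.
Proof.
elim: k t => [|k IHk] t; first by exists (padic_nat 0); rewrite [t]tuple0 tuple0.
have [s [a ->]] := tuple_rcons t; have [x <-] := IHk s.
have lt_ap : (a < p)%N by rewrite -[X in (_ < X)%N](Zp_cast p_gt1) ltn_ord.
(* [m] is x modulo p^k; residues start at modulus p, so k = 0 is set apart. *)
pose m := if k is k'.+1 then x k' : nat else 0%N.
have m_lt : (m < p ^ k)%N by rewrite /m; case: (k) => // k'; exact: residue_ltn.
exists (padic_nat (a * p ^ k + m)%N); rewrite digits_rcons.
congr [tuple of rcons _ _].
  apply/digits_eqP => i lt_ik; apply: val_inj => /=.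
  rewrite [X in (_ %% X)%N = _](Zp_cast (exp_gt1 i)) /m.
  clear t IHk s m m_lt; case: k lt_ik => // k lt_ik.
  rewrite (residue_mod x (lt_ik : i <= k)%N).
  have /dvdnP[q ->] : p ^ i.+1 %| a * p ^ k.+1 by rewrite dvdn_mull ?dvdn_exp2l.
  by rewrite modnMDl.
apply: val_inj; rewrite [LHS]digitE /= (Zp_cast (exp_gt1 k)) modn_small.
  by rewrite divnMDl ?expn_gt0 ?(ltnW p_gt1) // divn_small // addn0.
rewrite expnS (leq_trans _ (leq_mul lt_ap (leqnn _))) // mulSn addnC.
by rewrite ltn_add2r.
Qed.

End Digits.

(** * Cylinders, the p-adic topology and the Borel sets *)

Section Cylinders.
Local Open Scope classical_set_scope.
Local Open Scope ring_scope.
Variable p : nat.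
Hypothesis p_gt1 : (1 < p)%N.
Implicit Types x y z : padic_int p.

Definition cylinder k (t : k.-tuple 'Z_p) : set (padic_int p) :=
  [set x | digits x k = t].

Let p_gt0 : 0 < p%:R :> rat.
Proof. by rewrite ltr0n (ltnW p_gt1). Qed.

Lemma padic_norm_le z n : (forall i, (i < n)%N -> z i = 0) ->
  padic_norm z <= p%:R ^- n.
Proof.
move=> z0; rewrite /padic_norm; case: eqP => [_|nz].
  by rewrite invr_ge0 exprn_ge0 ?ltW.
rewrite lef_pV2 ?posrE ?exprn_gt0 // ler_eXn2l ?ltr1n // /padic_val.
(* The default value of [padic_val] cannot occur here: without a nonzero residue, [z] would be 0. *)
case: pselect => [h|[]]; last first.
  apply: contrapT => h; apply: nz; apply: padic_intP => i.
  by rewrite [RHS]inZp0; apply: contrapT => /eqP zi; apply: h; exists i.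
case: ex_minnP => m zm _; rewrite leqNgt; apply/negP => /z0 zm0.
by rewrite zm0 eqxx in zm.
Qed.

(** The strict bound forces a valuation above [n], whence one more vanishing residue than
    [padic_norm_le] asks for. *)
Lemma residue_eq0 z n i : padic_norm z < p%:R ^- n -> (i <= n)%N -> z i = 0.
Proof.
rewrite /padic_norm; case: eqP => [-> _ _|nz]; first by rewrite [LHS]inZp0.
rewrite ltf_pV2 ?posrE ?exprn_gt0 // ltr_eXn2l ?ltr1n // /padic_val.
case: pselect => [h|//]; case: ex_minnP => m zm min_m lt_nm le_in.
apply/eqP/negPn/negP => /min_m; apply/negP.
by rewrite -ltnNge (leq_ltn_trans le_in).
Qed.

Lemma cylinder_open k (t : k.-tuple 'Z_p) : open (cylinder t).
Proof.
move=> x xt; exists (p%:R ^- k); first by rewrite invr_gt0 exprn_gt0.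
move=> y xy; rewrite /cylinder /= -xt; apply/(digits_eqP p_gt1) => i lt_ik.
by apply/eqP; rewrite -subr_eq0; apply/eqP; apply: residue_eq0 xy (ltnW lt_ik).
Qed.

Lemma cylinder_basis (U : set (padic_int p)) x : open U -> U x ->
  exists k, cylinder (digits x k) `<=` U.
Proof.
move=> oU /oU[r r_gt0 rU].
have r1 : 0 <= r^-1 by rewrite invr_ge0 ltW.
(* With N > 1/r, the inequality p^N > N gives p^-N < r. *)
exists (Num.bound r^-1) => y yx; apply: rU.
apply: (@le_lt_trans _ _ (p%:R ^- Num.bound r^-1)).
  apply: padic_norm_le => i lt_i.
  by have /(digits_eqP p_gt1)/(_ i lt_i) /= yxi := yx; rewrite /= yxi subrr.
rewrite -[X in _ < X]invrK ltf_pV2 ?posrE ?exprn_gt0 ?invr_gt0 //.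
apply: (lt_le_trans (archi_boundP r1)); move: (Num.bound _) => N.
by rewrite -natrX ler_nat; apply: ltnW; exact: ltn_expl.
Qed.

Lemma cylinder_measurable k (t : k.-tuple 'Z_p) : measurable (cylinder t).
Proof. by apply: sub_sigma_algebra; exact: cylinder_open. Qed.

(** The empty set is included to obtain closure under intersection. *)
Definition cylinders : set (set (padic_int p)) :=
  [set A | A = set0 \/ exists k (t : k.-tuple 'Z_p), A = cylinder t].

(** Two cylinders are nested or disjoint, as the longer prefix extends the shorter one or
    contradicts it. *)
Lemma cylinders_setI : setI_closed cylinders.
Proof.
have ltP k l (s : k.-tuple 'Z_p) (t : l.-tuple 'Z_p) : (k <= l)%N ->
    cylinders (cylinder s `&` cylinder t).
  move=> le_kl; have [[x [xs xt]]|st] := pselect (cylinder s `&` cylinder t !=set0).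
    right; exists l, t; apply/seteqP; split=> [y []//|y yt]; split=> //.
    rewrite /cylinder /= -xs; apply/(digits_eqP p_gt1) => i lt_ik.
    have: digits y l = digits x l by rewrite xt.
    by move/(digits_eqP p_gt1); apply; exact: leq_trans le_kl.
  by left; apply/seteqP; split=> // x xst; case: st; exists x.
move=> A B [->|[k [s ->]]]; first by rewrite set0I; left.
case=> [->|[l [t ->]]]; first by rewrite setI0; left.
by case/orP: (leq_total k l) => [|lk]; [exact: ltP | rewrite setIC; exact: ltP].
Qed.

(** An open set is the union, over all levels k, of the finitely many level-k cylinders inside
    it. *)
Lemma measurable_cylinders :
  @measurable _ (padic_int p) = <<s cylinders >>.
Proof.
apply/seteqP; split; apply: smallest_sub; try exact: smallest_sigma_algebra.
  move=> U oU.
  have -> : U = \bigcup_k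
      \bigcup_(t in [set t : k.-tuple 'Z_p | cylinder t `<=` U]) cylinder t.
    apply/seteqP; split=> [x Ux|x [k _ [t tU xt]]]; last exact: tU.
    by have [k kU] := cylinder_basis oU Ux; exists k => //; exists (digits x k).
  apply: (@bigcupT_measurable _ (g_sigma_algebraType cylinders)) => k.
  apply: (@fin_bigcup_measurable _ (g_sigma_algebraType cylinders)) => // t _.
  by apply: sub_sigma_algebra; right; exists k, t.
move=> A [->|[k [t ->]]]; first exact: measurable0.
exact: cylinder_measurable.
Qed.

Lemma cylinder0 : cylinder ([tuple] : 0.-tuple 'Z_p) = setT.
Proof. by apply/seteqP; split=> // x _; rewrite /cylinder /= tuple0. Qed.

Lemma cylinder_measure_unique (R : realType)
    (m1 m2 : {measure set (padic_int p) -> \bar R}) :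
  (m1 setT < +oo)%E ->
  (forall k (t : k.-tuple 'Z_p), m1 (cylinder t) = m2 (cylinder t)) ->
  forall A, measurable A -> m1 A = m2 A.
Proof.
move=> m1T m12.
apply: (measure_unique _ (fun=> setT) measurable_cylinders cylinders_setI) => //.
- by move=> _; rewrite -cylinder0; right; exists 0%N, [tuple].
- by rewrite bigcup_const.
- by move=> A [->|[k [t ->]]]; rewrite ?measure0.
Qed.

(** * Haar measure of cylinders *)

Section Haar.
Variables (R : realType) (mu : probability (padic_int p) R).

(** The p^k cylinders of level k cut [B] into disjoint pieces. This serves for the whole space and
    for invariant sets. *)
Lemma measure_equidistributed k (B : set (padic_int p)) m : measurable B ->
  (forall t : k.-tuple 'Z_p, mu (B `&` cylinder t) = m) ->
  mu B = ((p ^ k)%:R%:E * m)%E.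
Proof.
move=> mB mt.
have -> : B = \bigcup_(t in [set: k.-tuple 'Z_p]) (B `&` cylinder t).
  apply/seteqP; split=> [x Bx|x [t _ []]] //.
  by exists (digits x k).
rewrite measure_fin_bigcup //=; last 2 first.
- by move=> s t _ _ [x [[_ xs] [_ xt]]]; rewrite -xs -xt.
- by move=> t _; apply: measurableI => //; exact: cylinder_measurable.
rewrite (fsbigE (enum {: k.-tuple 'Z_p})) ?enum_uniq //=; last first.
  by move=> t _; rewrite mem_enum.
rewrite (eq_bigr (fun=> m)) // big_const_seq -Monoid.iteropE mule_natl.
congr (iterop _ _ _ _).
rewrite -(card_digits p_gt1) cardE -count_predT.
by apply: eq_count => t; rewrite mem_set.
Qed.

Hypothesis mu_haar : is_haar mu.

(** Translation by [y - x] carries the cylinder of [x] onto that of [y]. *)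
Lemma haar_cylinder_eq k (s t : k.-tuple 'Z_p) :
  mu (cylinder s) = mu (cylinder t).
Proof.
have [x xs] := digits_surj p_gt1 s; have [y yt] := digits_surj p_gt1 t.
rewrite -(mu_haar (y - x) (cylinder_measurable s)); congr (mu _).
have sub u v w (a b : k.-tuple 'Z_p) : digits u k = a -> digits v k = b ->
    digits w k = a -> digits (v - u + w) k = b.
  move=> <- <- /(digits_eqP p_gt1) wu; apply/(digits_eqP p_gt1) => i /wu.
  by rewrite /= => ->; rewrite subrK.
apply/seteqP; split=> [_ [z zs <-]|z zt]; first exact: sub xs yt zs.
exists (x - y + z); first exact: sub yt xs zt.
by rewrite addrA -[y - x]opprB addNr add0r.
Qed.

Lemma haar_cylinderE k (t : k.-tuple 'Z_p) : ((p ^ k)%:R%:E * mu (cylinder t))%E = 1%E.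
Proof.
rewrite -(probability_setT mu); symmetry; apply: measure_equidistributed => // s.
by rewrite setTI; exact: haar_cylinder_eq.
Qed.

Lemma haar_cylinder_gt0 k (t : k.-tuple 'Z_p) : (0 < mu (cylinder t))%E.
Proof.
rewrite lt0e measure_ge0 andbT; apply/eqP => t0.
by have := haar_cylinderE t; rewrite t0 mule0 => /esym/eqP; rewrite onee_eq0.
Qed.

(** * Ergodicity of maps that permute the cylinders of each level *)

Section Induced.
Variable f : padic_int p -> padic_int p.
Variable g : forall k, k.-tuple 'Z_p -> k.-tuple 'Z_p.
Hypothesis g_inj : forall k, injective (@g k).
Hypothesis digits_f : forall x k, digits (f x) k = g (digits x k).

Lemma preimage_cylinder k (t : k.-tuple 'Z_p) :
  f @^-1` cylinder (g t) = cylinder t.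
Proof.
by apply/seteqP; split=> x; rewrite /cylinder /= digits_f; [exact: g_inj|move->].
Qed.

Lemma preimage_cylinderV k (t : k.-tuple 'Z_p) :
  f @^-1` cylinder t = cylinder (finv (@g k) t).
Proof. by rewrite -[RHS]preimage_cylinder (f_finv (@g_inj k)). Qed.

Lemma digitwise_measurable : measurable_fun setT f.
Proof.
apply: (measurability _ measurable_cylinders) => _ [_ [->|[k [t ->]]] <-].
  by rewrite preimage_set0 setI0.
by rewrite setTI preimage_cylinderV; exact: cylinder_measurable.
Qed.

Lemma digitwise_measure_preserving : measure_preserving mu f.
Proof.
split; first exact: digitwise_measurable.
have fm := digitwise_measurable.
(* Bundling [f] makes its pushforward of [mu] a measure, which is compared with [mu] on
   cylinders. *)
pose f' : {mfun padic_int p >-> padic_int p} := mfun_Sub (mem_set fm).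
move=> A mA; symmetry.
apply: (@cylinder_measure_unique R mu (pushforward mu f')) => //.
  by rewrite [X in (X < _)%E](probability_setT mu) ltry.
move=> k t; have := haar_cylinder_eq t (finv (@g k) t).
by rewrite -preimage_cylinderV.
Qed.

(** For invariant [A], pulling the part of [A] in the cylinder of [g t] back by [f] gives its part
    in the cylinder of [t]. *)
Lemma invariant_cylinder_measure (A : set (padic_int p)) k (s t : k.-tuple 'Z_p) :
  measurable A -> f @^-1` A = A -> fconnect (@g k) s t ->
  mu (A `&` cylinder t) = mu (A `&` cylinder s).
Proof.
move=> mA fA /iter_findex <-; elim: (findex _ _ _) => //= n <-.
have [_ <-] := digitwise_measure_preserving.
  by rewrite preimage_setI fA preimage_cylinder.
by apply: measurableI => //; exact: cylinder_measurable.
Qed.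

Lemma ergodic_digitwise : ergodic mu f <-> forall k s t, fconnect (@g k) s t.
Proof.
split=> [[_ f_erg] k s t|g_tr]; last first.
  split=> [|A mA fA]; first exact: digitwise_measure_preserving.
  have /fineK : mu A \is a fin_num by exact: fin_num_measure.
  set a := fine _ => aE.
  have a_ge0 : 0 <= a by rewrite fine_ge0.
  (* All level-k cylinders form one orbit, so each carries the share p^-k of [mu A], and p^-k is its
     own measure. *)
  have indep k (t : k.-tuple 'Z_p) : mu (cylinder t `&` A) = (a%:E * mu (cylinder t))%E.
    have /fineK : mu (cylinder t `&` A) \is a fin_num.
      by apply: fin_num_measure; apply: measurableI => //; exact: cylinder_measurable.
    set b := fine _ => bE.
    have /fineK : mu (cylinder t) \is a fin_num.
      by apply: fin_num_measure; exact: cylinder_measurable.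
    set c := fine _ => cE.
    have := haar_cylinderE t; rewrite -cE -EFinM => -[c1].
    have : mu A = ((p ^ k)%:R%:E * mu (cylinder t `&` A))%E.
      apply: measure_equidistributed => // s.
      by rewrite [cylinder t `&` A]setIC; exact: invariant_cylinder_measure.
    rewrite -aE -bE -!EFinM => -[->].
    by rewrite mulrAC c1 mul1r.
  (* The restriction of [mu] to [A] and the multiple of [mu] by [a] agree on cylinders, hence on [A]
     itself. *)
  have muAA : mu (A `&` A) = (a%:E * mu A)%E.
    apply: (@cylinder_measure_unique R (mrestr mu mA) (mscale (NngNum a_ge0) mu)) => //.
    have : (mu (setT `&` A) < +oo)%E by rewrite setTI -aE ltry.
    exact.
  have aa : a = a * a by apply: EFin_inj; rewrite EFinM [X in (_ * X)%E]aE -muAA setIid.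
  have : a * (1 - a) == 0 by rewrite mulrBr mulr1 -aa subrr.
  rewrite mulf_eq0 subr_eq0 -aE => /orP[/eqP a0|/eqP a1]; first by left; rewrite a0.
  by right; rewrite -a1.
pose A := [set x | fconnect (@g k) s (digits x k)].
have mA : measurable A.
  have -> : A = \bigcup_(u in [set u | fconnect (@g k) s u]) cylinder u.
    apply/seteqP; split=> [x sx|x [u su xu]]; first by exists (digits x k).
    by rewrite /A /= xu.
  by apply: fin_bigcup_measurable => // u _; exact: cylinder_measurable.
(* Injectivity makes the orbit of [s] closed under preimages too. *)
have fA : f @^-1` A = A.
  by apply/seteqP; split=> x; rewrite /A /= digits_f -(same_fconnect1_r (@g_inj k)).
have sA : cylinder s `<=` A by move=> x xs; rewrite /A /= xs connect0.
have [A0|A1] := f_erg A mA fA.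
  have : (mu (cylinder s) <= mu A)%E.
    exact: le_measure (mem_set (cylinder_measurable s)) (mem_set mA) sA.
  by rewrite A0 leNgt haar_cylinder_gt0.
(* Were [t] off the orbit, its cylinder, of positive measure, would lie in the null complement of
   [A]. *)
apply: contrapT => st.
have tA : cylinder t `<=` ~` A by move=> x xt; rewrite /A /= xt.
have : (mu (cylinder t) <= mu (~` A))%E.
  exact: le_measure (mem_set (cylinder_measurable t)) (mem_set (measurableC mA)) tA.
by rewrite probability_setC // A1 subee // leNgt haar_cylinder_gt0.
Qed.

End Induced.
End Haar.
End Cylinders.

(** * Digit prefixes as a tower of skew products *)

Section Coordinates.
Variable p : nat.
Hypothesis p_gt1 : (1 < p)%N.
Variables (f : padic_int p -> padic_int p) (phi : forall k, k.+1.-tuple 'Z_p -> 'Z_p).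
Hypothesis f_phi : coordinate_representation f phi.
Hypothesis phi_inj : forall k (s : k.-tuple 'Z_p), injective (coord_section phi s).

(* Unqualified, [induced] would be the homonym of MathComp-Analysis. *)
Lemma digits_induced x k : digits (f x) k = Defs.induced phi (digits x k).
Proof.
apply: eq_from_tnth => i; rewrite !tnth_mktuple f_phi; apply: (congr1 (@phi i)).
by apply: eq_from_tnth => j; rewrite !tnth_mktuple.
Qed.

(** This is the skew product structure; realizing the tuple as digits of a p-adic integer reduces it
    to [digits_induced]. *)
Lemma induced_rcons k (s : k.-tuple 'Z_p) a :
  Defs.induced phi [tuple of rcons s a] =
  [tuple of rcons (Defs.induced phi s) (coord_section phi s a)].
Proof.
have [x xE] := digits_surj p_gt1 [tuple of rcons s a].
rewrite -xE -digits_induced digits_rcons f_phi digits_induced xE.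
by move: xE; rewrite digits_rcons => /(@rcons_tuple_inj _ _ _ _ _ _)[->].
Qed.

Lemma induced_inj k : injective (@Defs.induced p phi k).
Proof.
elim: k => [|k IHk] s t; first by rewrite [s]tuple0 [t]tuple0.
have [s' [a ->]] := tuple_rcons s; have [t' [b ->]] := tuple_rcons t.
by rewrite !induced_rcons => /(@rcons_tuple_inj _ _ _ _ _ _)[/IHk-> /phi_inj->].
Qed.

Lemma coord_comp_fiber k (s : k.-tuple 'Z_p) n :
  coord_comp phi s n = fiber_comp (@Defs.induced p phi k) (@coord_section p phi k) s n.
Proof. by elim: n => //= n ->. Qed.

Lemma coord_cycleE k (s : k.-tuple 'Z_p) :
  coord_cycle phi s =
  fiber_comp (@Defs.induced p phi k) (@coord_section p phi k) s #|{: k.-tuple 'Z_p}|.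
Proof. by rewrite /coord_cycle coord_comp_fiber card_digits. Qed.

Lemma coord_cycle_inj k (s : k.-tuple 'Z_p) : injective (coord_cycle phi s).
Proof. by rewrite coord_cycleE; apply: fiber_comp_inj; exact: phi_inj. Qed.

Lemma induced_transitiveS k :
  (forall s t, fconnect (@Defs.induced p phi k) s t) ->
  (forall s t, fconnect (@Defs.induced p phi k.+1) s t) <->
  (forall (s : k.-tuple 'Z_p) a b, fconnect (coord_cycle phi s) a b).
Proof.
move=> tr_k; have := skew_transitive (@coord_section p phi k) (@induced_inj k) tr_k.
set G := (fun _ => _) => skew.
(* Appending the last digit conjugates [G] to the induced map one level up. *)
pose snoc (u : k.-tuple 'Z_p * 'Z_p) := [tuple of rcons u.1 u.2].
have iter_snoc n u : iter n (@Defs.induced p phi k.+1) (snoc u) = snoc (iter n G u).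
  by elim: n => //= n ->; rewrite induced_rcons.
split=> [tr s a b|tr s t].
  rewrite coord_cycleE; apply: (skew.1 _ s a b) => u v.
  have /iter_findex := tr (snoc u) (snoc v); rewrite iter_snoc.
  move=> /(@rcons_tuple_inj _ _ _ _ _ _)[e1 e2].
  rewrite [v]surjective_pairing -e1 -e2 -surjective_pairing.
  exact: fconnect_iter.
have [s' [a ->]] := tuple_rcons s; have [t' [b ->]] := tuple_rcons t.
have /iter_findex : fconnect G (s', a) (t', b).
  by apply: skew.2 => r x y; rewrite -coord_cycleE.
rewrite -[X in fconnect _ _ X]/(snoc (t', b)) => <-.
by rewrite -iter_snoc; exact: fconnect_iter.
Qed.

(** Induction on the level, starting from the single empty prefix. *)
Lemma induced_transitiveP :
  (forall k s t, fconnect (@Defs.induced p phi k) s t) <->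
  (forall k (s : k.-tuple 'Z_p), transitive_perm (coord_cycle phi s)).
Proof.
have Z_gt0 : (0 < #|'Z_p|)%N by rewrite card_ord.
have cycleP k (s : k.-tuple 'Z_p) := transitive_permP (@coord_cycle_inj k s) Z_gt0.
split=> [tr k s|tr].
  by apply/cycleP; apply: (induced_transitiveS (tr k)).1.
elim=> [|k IHk]; first by move=> s t; rewrite [s]tuple0 [t]tuple0.
by apply/(induced_transitiveS IHk) => s; apply/cycleP.
Qed.

End Coordinates.

Theorem theorem3p2 (R : realType) (p : nat) (p_prime : prime p)
    (mu : probability (padic_int p) R) (mu_haar : is_haar mu)
    (f : padic_int p -> padic_int p) (f_compatible : compatible f)
    (phi : forall k : nat, k.+1.-tuple 'Z_p -> 'Z_p)
    (f_phi : coordinate_representation f phi)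
    (phi0_perm : bijective (fun x0 : 'Z_p => phi 0%N [tuple x0]))
    (phi_perm : forall (k : nat) (xbar : k.-tuple 'Z_p), (1 <= k)%N ->
       bijective (coord_section phi xbar)) :
  ergodic mu f <->
  transitive_perm (fun x0 : 'Z_p => phi 0%N [tuple x0]) /\
  (forall (k : nat) (xbar : k.-tuple 'Z_p), (1 <= k)%N ->
     transitive_perm (coord_cycle phi xbar)).
Proof.
have p_gt1 := prime_gt1 p_prime.
(* At k = 0 the prefix is empty and the product has p^0 = 1 factor, so the conditions on [phi 0] are
   the k = 0 instances of those on sections and cycles. *)
have section0 (s : 0.-tuple 'Z_p) :
    coord_section phi s = fun x0 => phi 0%N [tuple x0].
  apply: functional_extensionality_dep => x0; rewrite [s]tuple0 /coord_section.
  by apply: (congr1 (@phi 0%N)); apply: val_inj.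
have cycle0 (s : 0.-tuple 'Z_p) : coord_cycle phi s = fun x0 => phi 0%N [tuple x0].
  by rewrite -(section0 s).
have phi_inj k (s : k.-tuple 'Z_p) : injective (coord_section phi s).
  by apply: bij_inj; case: k s => [|k] s; [rewrite section0 | exact: phi_perm].
have erg := ergodic_digitwise p_gt1 mu_haar (induced_inj p_gt1 f_phi phi_inj)
  (digits_induced f_phi).
have tr := induced_transitiveP p_gt1 f_phi phi_inj.
split=> [/erg/tr tr_phi|[tr0 trS]].
  by split=> [|k s _]; [rewrite -(cycle0 [tuple]) | exact: tr_phi].
by apply/erg/tr => -[|k] s; [rewrite cycle0 | exact: trS].
Qed.
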